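(* Let $\Delta$ be a $d$-dimensional lattice simplex, $N=N_\Delta$, and let $g_\Delta$ be an $m\times(d+1)$ matrix over $\mathbb{Z}_N$ whose rows generate the code $C_\Delta$; denote its columns by $g_0,\dots,g_d$ and put $H_i=\{x\in\mathbb{Z}_N^m: g_i\cdot x=0 \bmod N\}$. Then $\Delta$ is thin if and only if the complement of the hyperplane arrangement $\mathcal{H}_\Delta=\{H_0,\dots,H_d\}$ is empty, i.e. $\mathbb{Z}_N^m=H_0\cup H_1\cup\dots\cup H_d$.
   Context: Let $M\cong\mathbb{Z}^d$ be a lattice and $\Delta$ a $d$-dimensional lattice simplex in $M\otimes\mathbb{R}$ with vertices $v_0,\dots,v_d\in M$. The local $h^*$-polynomial is $l^*(\Delta,t)=\sum_{\lambda}t^{\lambda_{d+1}}$, the sum being over the points $\lambda\in M\oplus\mathbb{Z}$ in the open parallelepiped $\Pi_\Delta^\circ=\{\sum_{i=0}^d a_i(v_i,1):0<a_i<1\}$, where $\lambda_{d+1}$ is the last coordinate. $\Delta$ is called thin if $l^*(\Delta,t)=0$. Code of a simplex: $\mathbb{Z}_N=\mathbb{Z}/N\mathbb{Z}$. Let $\Lambda_\Delta=\{x\in(\mathbb{R}/\mathbb{Z})^{d+1}:\sum_i\{x_i\}(v_i,1)\in M\oplus\mathbb{Z}\}$, where $\{\cdot\}$ is the fractional part. $N_\Delta$ is the least common multiple of the denominators of all coordinates of elements of $\Lambda_\Delta$, and $C_\Delta=\{(N_\Delta\{x_0\},\dots,N_\Delta\{x_d\}):x\in\Lambda_\Delta\}\subseteq\mathbb{Z}_{N_\Delta}^{d+1}$,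 a $\mathbb{Z}_{N_\Delta}$-submodule. *)

(* Defs.v *)
From HB Require Import structures.
From mathcomp Require Import all_boot all_order all_algebra.
From mathcomp Require Import all_classical all_reals.

Set Implicit Arguments.
Unset Strict Implicit.
Unset Printing Implicit Defensive.
Set Warnings "-redundant-canonical-projection".

Import Order.TTheory GRing.Theory Num.Theory.

Local Open Scope classical_set_scope.
Local Open Scope ring_scope.

(* The ring Z/NZ for every N >= 1.  MathComp's 'Z_N denotes Z/2Z when N = 1,
   whereas N = 1 does occur here (unimodular simplices), and must give the
   zero ring.  For N = 0, Zmod N is also the zero ring. *)
Definition Zmod (N : nat) : Type := 'I_N.-1.+1.

HB.instance Definition _ N := GRing.Zmodule.on (Zmod N).
HB.instance Definition _ N := Finite.on (Zmod N).
HB.instance Definition _ N :=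
  GRing.Zmodule_isComPzRing.Build (Zmod N)
    (@Zp_mulA N.-1.+1) (@Zp_mulC N.-1.+1) (@Zp_mul1z N.-1)
    (@Zp_mul_addl N.-1.+1).

Definition Zmod_repr (N : nat) (c : Zmod N) : nat := nat_of_ord c.

Definition affinely_independent (R : realType) (d n : nat)
    (p : 'I_n -> 'rV[R]_d) : Prop :=
  forall c : 'I_n -> R,
    \sum_i c i = 0 -> \sum_i c i *: p i = 0 -> forall i, c i = 0.

(* The inclusion of M (+) Z into (M (+) Z) (x) R, where M = Z^d. *)
Definition to_real (R : realType) (d : nat) (u : 'rV[int]_d * int) :
    'rV[R]_d * R^o :=
  (map_mx intr u.1, u.2%:~R).

(* v lists the vertices v_0, ..., v_d of a full-dimensional lattice simplex. *)
Definition simplex_vertices (R : realType) (d : nat)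
    (v : 'I_d.+1 -> 'rV[int]_d) : Prop :=
  affinely_independent (fun i => map_mx intr (v i) : 'rV[R]_d).

Definition cone_comb (R : realType) (d : nat) (v : 'I_d.+1 -> 'rV[int]_d)
    (a : 'I_d.+1 -> R) : 'rV[R]_d * R^o :=
  \sum_i a i *: to_real R (v i, 1).

Definition open_box_points (R : realType) (d : nat)
    (v : 'I_d.+1 -> 'rV[int]_d) : set ('rV[int]_d * int) :=
  [set u | exists2 a : 'I_d.+1 -> R,
     (forall i, 0 < a i < 1) & to_real R u = cone_comb v a].

(* The index set is finite, so the finitely supported sum below is the true
   sum, and the last coordinate u.2 of each of its points is positive. *)
Definition local_hstar (R : realType) (d : nat)
    (v : 'I_d.+1 -> 'rV[int]_d) : {poly int} :=
  \sum_(u \in open_box_points R v) ('X^(`|u.2|%N) : {poly int}).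

Definition thin (R : realType) (d : nat) (v : 'I_d.+1 -> 'rV[int]_d) : Prop :=
  local_hstar R v = 0.

Definition frac_part (R : realType) (x : R) : R := x - (Num.floor x)%:~R.

(* Lambda_Delta; an element of (R/Z)^(d+1) is given by any real
   representative, and only fractional parts of coordinates are ever used. *)
Definition Lambda (R : realType) (d : nat) (v : 'I_d.+1 -> 'rV[int]_d) :
    set ('I_d.+1 -> R) :=
  [set x | exists u : 'rV[int]_d * int,
     cone_comb v (fun i => frac_part (x i)) = to_real R u].

Definition Lambda_denominators (R : realType) (d : nat)
    (v : 'I_d.+1 -> 'rV[int]_d) : set nat :=
  [set n | exists (x : 'I_d.+1 -> R) (i : 'I_d.+1) (q : rat),
     [/\ Lambda v x, frac_part (x i) = ratr q & n = `|denq q|%N]].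

(* N_Delta; for affinely independent v the set of denominators is finite. *)
Definition code_modulus (R : realType) (d : nat)
    (v : 'I_d.+1 -> 'rV[int]_d) : nat :=
  \big[lcmn/1%N]_(n \in Lambda_denominators R v) n.

Definition simplex_code (R : realType) (d : nat) (v : 'I_d.+1 -> 'rV[int]_d) :
    set 'rV[Zmod (code_modulus R v)]_d.+1 :=
  [set c | exists2 x : 'I_d.+1 -> R, Lambda v x &
     forall i, (Zmod_repr (c 0 i))%:R = (code_modulus R v)%:R * frac_part (x i)].

Arguments simplex_code R {d} v.

Definition row_span (S : pzRingType) (m n : nat) (g : 'M[S]_(m, n)) :
    set 'rV[S]_n :=
  [set c | exists a : 'I_m -> S, c = \sum_k a k *: row k g].

Definition hyperplane (S : pzRingType) (m n : nat) (g : 'M[S]_(m, n))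
    (i : 'I_n) : set 'cV[S]_m :=
  [set x | \sum_k col i g k 0 * x k 0 = 0].

Definition arrangement_complement (S : pzRingType) (m n : nat)
    (g : 'M[S]_(m, n)) : set 'cV[S]_m :=
  ~` \bigcup_i hyperplane g i.

(* Main.v *)
(** Evaluating at [t = 1], [l^*] counts the points of the open parallelepiped,
    so [Delta] is thin iff there is no such point.  A point with coefficients
    [a_i] in [(0,1)] is the same thing as a codeword [(N a_i)_i] all of whose
    entries are nonzero, and the codewords are the vectors [(g_i . x)_i], for
    [x] ranging over [Z_N^m]; such a codeword has no zero entry iff [x] avoids
    every [H_i].  That [N a_i] is an integer is Cramer's rule: the denominators
    of the [a_i] divide the determinant of the matrix with rows [(v_i, 1)]. *)
Require Import Defs.
From mathcomp Require Import all_boot all_order all_algebra.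
From mathcomp Require Import all_classical all_reals.

Set Implicit Arguments.
Unset Strict Implicit.

Import Order.TTheory GRing.Theory Num.Theory.

Local Open Scope classical_set_scope.
Local Open Scope ring_scope.

(* The last coordinate of M (+) Z is put in position 0. *)
Definition homogenize (d : nat) (u : 'rV[int]_d * int) : 'rV[int]_d.+1 :=
  \row_j oapp (u.1 0) u.2 (unlift ord0 j).

Definition vertex_matrix (d : nat) (v : 'I_d.+1 -> 'rV[int]_d) : 'M[int]_d.+1 :=
  \matrix_(i < d.+1) homogenize (v i, 1).

Lemma cone_combE (R : realType) (d : nat) (v : 'I_d.+1 -> 'rV[int]_d)
    (a : 'I_d.+1 -> R) :
  cone_comb v a =
  (\sum_i a i *: (map_mx intr (v i) : 'rV[R]_d), (\sum_i a i) : R^o).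
Proof.
rewrite /cone_comb; apply: (big_rec3 (fun x y z => x = (y, z))) => //.
by move=> i x y z _ ->; congr pair; rewrite /= [_ *: _]mulr1.
Qed.

Lemma cone_comb_homogenize (R : realType) (d : nat)
    (v : 'I_d.+1 -> 'rV[int]_d) (a : 'I_d.+1 -> R) (u : 'rV[int]_d * int) :
  to_real R u = cone_comb v a ->
  (\row_i a i) *m map_mx intr (vertex_matrix v) = map_mx intr (homogenize u).
Proof.
rewrite cone_combE => -[e1 e2]; apply/rowP => j; rewrite !mxE.
under eq_bigr do rewrite !mxE.
case: unliftP => [k|] _ /=; last first.
  by rewrite e2; apply: eq_bigr => i _; rewrite mulr1.
move/rowP/(_ k): e1; rewrite !mxE => ->; rewrite summxE.
by apply: eq_bigr => i _; rewrite !mxE.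
Qed.

(** A left kernel vector is an affine dependence between the vertices: column 0 makes its entries
    sum to zero, the other columns make the weighted sum of the [v i] vanish. *)
Lemma det_vertex_matrix_neq0 (R : realType) (d : nat)
    (v : 'I_d.+1 -> 'rV[int]_d) :
  simplex_vertices R v -> \det (vertex_matrix v) != 0.
Proof.
move=> vs; rewrite -(intr_eq0 R) -det_map_mx; apply/det0P => -[w w0 wA].
move/eqP: w0; apply; apply/rowP => i; rewrite mxE.
apply: (vs (w 0)).
  move/rowP/(_ ord0): wA; rewrite !mxE => wA; rewrite -[RHS]wA.
  by apply: eq_bigr => k _; rewrite !mxE unlift_none mulr1.
apply/rowP => j; move/rowP/(_ (lift ord0 j)): wA; rewrite !mxE => wA.
rewrite -[RHS]wA summxE; apply: eq_bigr => k _.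
by rewrite !mxE liftK.
Qed.

(** Multiplying the homogenized identity by the adjugate leaves the determinant times [a] on one
    side; the other side stays integral because the adjugate has integer entries. *)
Lemma cramer_cone_comb (R : realType) (d : nat) (v : 'I_d.+1 -> 'rV[int]_d)
    (a : 'I_d.+1 -> R) (u : 'rV[int]_d * int) (i : 'I_d.+1) :
  to_real R u = cone_comb v a ->
  exists z : int, a i * (\det (vertex_matrix v))%:~R = z%:~R.
Proof.
pose adjA : 'M[R]_d.+1 := map_mx intr (\adj (vertex_matrix v)).
move/cone_comb_homogenize => /(congr1 (mulmx^~ adjA)).
rewrite -mulmxA -!map_mxM mul_mx_adj map_scalar_mx mul_mx_scalar.
by move=> /rowP/(_ i); rewrite !mxE mulrC => ->; eexists.
Qed.

Lemma dvdz_denq (q : rat) (D z : int) : q * D%:~R = z%:~R -> (denq q %| D)%Z.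
Proof.
move=> e; suff : (denq q %| numq q * D)%Z.
  by rewrite Gauss_dvdzr // coprimezE coprime_sym coprime_num_den.
apply/dvdzP; exists z; apply: (@intr_inj rat).
by rewrite !intrM -e numqE mulrAC.
Qed.

Lemma frac_part_id (R : realType) (x : R) : 0 <= x < 1 -> frac_part x = x.
Proof.
move=> x01; rewrite /frac_part (_ : Num.floor x = 0) ?subr0 //.
by apply: floor_def; rewrite add0r.
Qed.

Lemma frac_part_itv (R : realType) (x : R) : 0 <= frac_part x < 1.
Proof.
by rewrite /frac_part subr_ge0 ltrBlDr ge_floor addrC -intrD1 floorD1_gt.
Qed.

Lemma Lambda_denominators_dvd (R : realType) (d : nat)
    (v : 'I_d.+1 -> 'rV[int]_d) (n : nat) :
  Lambda_denominators R v n -> (n %| `|\det (vertex_matrix v)|)%N.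
Proof.
move=> [x [i [q [[u /esym ux] xq ->]]]].
have [z] := cramer_cone_comb i ux.
(* Both sides are images of rationals under [ratr], whose injectivity brings the identity down to
   [rat]. *)
rewrite xq -ratr_int -rmorphM -[z%:~R]ratr_int => /fmorph_inj; exact: dvdz_denq.
Qed.

(** A nonzero determinant has finitely many divisors. Without finiteness the iterated lcm in
    [code_modulus] could take its default value 1. *)
Lemma finite_Lambda_denominators (R : realType) (d : nat)
    (v : 'I_d.+1 -> 'rV[int]_d) :
  simplex_vertices R v -> finite_set (Lambda_denominators R v).
Proof.
move=> vs; apply: (sub_finite_set _ (finite_II `|\det (vertex_matrix v)|.+1)).
move=> n /Lambda_denominators_dvd /dvdn_leq; rewrite /= ltnS; apply.
by rewrite absz_gt0 (det_vertex_matrix_neq0 vs).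
Qed.

Lemma dvdn_code_modulus (R : realType) (d : nat) (v : 'I_d.+1 -> 'rV[int]_d)
    (n : nat) :
  simplex_vertices R v -> Lambda_denominators R v n ->
  (n %| code_modulus R v)%N.
Proof.
move=> vs nL; have fL := finite_Lambda_denominators vs.
rewrite /code_modulus fsbig_finite //= (big_rem n) ?dvdn_lcml //=.
by rewrite in_fset_set // inE.
Qed.

Lemma code_modulus_gt0 (R : realType) (d : nat) (v : 'I_d.+1 -> 'rV[int]_d) :
  simplex_vertices R v -> (0 < code_modulus R v)%N.
Proof.
move=> vs; have fL := finite_Lambda_denominators vs.
rewrite /code_modulus fsbig_finite //= big_seq.
apply: (big_ind (fun n => 0 < n)%N) => // [m n m0 n0|n].
  by rewrite lcmn_gt0 m0.
rewrite in_fset_set // inE => -[x [i [q [_ _ ->]]]].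
by rewrite absz_gt0 denq_neq0.
Qed.

(** The bound on [k] makes it the canonical representative of a residue, so that it can serve as a
    code entry. *)
Lemma code_modulus_coef (R : realType) (d : nat) (v : 'I_d.+1 -> 'rV[int]_d)
    (a : 'I_d.+1 -> R) (u : 'rV[int]_d * int) (i : 'I_d.+1) :
  simplex_vertices R v -> (forall j, 0 < a j < 1) ->
  to_real R u = cone_comb v a ->
  exists2 k : nat, (k < code_modulus R v)%N &
    k%:R = (code_modulus R v)%:R * a i.
Proof.
move=> vs a01 ua.
have fa j : frac_part (a j) = a j.
  by apply: frac_part_id; have /andP[/ltW -> ->] := a01 j.
have [z az] := cramer_cone_comb i ua.
have D0 := det_vertex_matrix_neq0 vs.
set q : rat := z%:~R / (\det (vertex_matrix v))%:~R.
have aq : a i = ratr q.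
  by rewrite fmorph_div /= !ratr_int -az mulfK // intr_eq0.
have /(dvdn_code_modulus vs)/dvdnP[c Nc] :
    Lambda_denominators R v `|denq q|%N.
  (* Coefficients in (0,1) are their own fractional parts, so [a] itself lies in [Lambda]. *)
  exists a, i, q; split=> //; last by rewrite fa.
  exists u; rewrite ua; congr cone_comb; exact/funext.
have [w Na] : exists w : int, (code_modulus R v)%:R * a i = w%:~R.
  (* The modulus is [c] times the denominator of [q], and [a i] is [q]. *)
  exists (c%:Z * numq q).
  rewrite Nc aq -[(_ * _)%N%:R]ratr_nat -rmorphM /= natrM.
  rewrite -[`|denq q|%N%:R]/(`|denq q|%N%:Z%:~R) absz_denq.
  by rewrite -mulrA [_%:~R * q]mulrC -numqE pmulrn -intrM ratr_int.
have N0 : (0 : R) < (code_modulus R v)%:R by rewrite ltr0n code_modulus_gt0.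
have /andP[a0 a1] := a01 i.
have w0 : 0 <= w by rewrite -(ler0z R) -Na mulr_ge0 ?ltW.
exists `|w|%N; last by rewrite Na natr_absz ger0_norm.
by rewrite -(ltr_nat R) natr_absz ger0_norm // -Na gtr_pMr.
Qed.

Lemma finite_bounded_lattice_points (d : nat) (B : nat) :
  finite_set [set u : 'rV[int]_d * int |
    (forall j, `|u.1 0 j| <= B%:Z) /\ `|u.2| <= B%:Z].
Proof.
(* [dec] shifts 0..2B onto -B..B, so the bounded points lie in the image of a finite type. *)
pose dec (k : 'I_(B + B).+1) : int := (k : nat)%:Z - B%:Z.
pose F (f : {ffun 'I_d -> 'I_(B + B).+1} * 'I_(B + B).+1) :
  'rV[int]_d * int := (\row_j dec (f.1 j), dec f.2).
have decK (z : int) : `|z| <= B%:Z -> dec (inord `|(z + B%:Z)%R|%N) = z.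
  rewrite ler_norml => /andP[z1 z2]; rewrite /dec.
  have zB : 0 <= z + B%:Z by rewrite -lerBlDr sub0r.
  rewrite inordK; first by rewrite gez0_abs // addrK.
  by rewrite ltnS -lez_nat gez0_abs // PoszD lerD2r.
have finF : finite_set (range F) by exact/finite_image/finite_finset.
apply: sub_finite_set finF => -[u k] /= [hu hk].
exists ([ffun j => inord `|(u 0 j + B%:Z)%R|%N], inord `|(k + B%:Z)%R|%N) => //.
congr pair; last exact: decK.
by apply/rowP => j; rewrite !mxE ffunE decK.
Qed.

Lemma finite_open_box_points (R : realType) (d : nat)
    (v : 'I_d.+1 -> 'rV[int]_d) : finite_set (open_box_points R v).
Proof.
pose A := vertex_matrix v.
(* As the coefficients are below 1, column sums of absolute values bound the coordinates; the sum
   over all entries bounds every column at once. *)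
pose B := (\sum_i \sum_j `|A i j|%N)%N.
apply: (sub_finite_set _ (@finite_bounded_lattice_points d B)) => u [a a01 ua].
have {ua} ua j : (homogenize u 0 j)%:~R = \sum_i a i * (A i j)%:~R.
  have /rowP/(_ j) := cone_comb_homogenize ua.
  rewrite [RHS]mxE mxE => <-.
  by apply: eq_bigr => i _; rewrite [map_mx _ _ _ _]mxE mxE.
have bound j : `|homogenize u 0 j| <= B%:Z.
  rewrite -(ler_int R) intr_norm ua (le_trans (ler_norm_sum _ _ _)) //.
  rewrite -pmulrn natr_sum ler_sum // => i _.
  have /andP[a0 a1] := a01 i.
  rewrite normrM gtr0_norm // (le_trans (ler_piMl _ (ltW a1))) //.
  by rewrite -intr_norm -natr_absz ler_nat (bigD1 j) //= leq_addr.
split=> [j|].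
  by have := bound (lift ord0 j); rewrite mxE liftK.
by have := bound ord0; rewrite mxE unlift_none.
Qed.

Lemma thinP (R : realType) (d : nat) (v : 'I_d.+1 -> 'rV[int]_d) :
  thin R v <-> open_box_points R v = set0.
Proof.
split=> [|box0]; last by rewrite /thin /local_hstar box0 fsbig_set0.
have fin := @finite_open_box_points R d v.
rewrite /thin /local_hstar fsbig_finite // => /(congr1 (horner^~ 1)).
rewrite horner0 horner_sum.
under eq_bigr do rewrite hornerXn expr1n -[1](mulr1n 1).
(* Each box point contributes the natural number 1, so a zero sum leaves no room for any point. *)
rewrite -natr_sum => /eqP; rewrite pnatr_eq0 sum_nat_seq_eq0 => /allP no.
rewrite -subset0 => u uP.
by have := no u; rewrite in_fset_set // inE => /(_ uP).
Qed.

Lemma Zmod_repr_eq0 (N : nat) (c : Zmod N) : (Zmod_repr c == 0%N) = (c == 0).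
Proof. by []. Qed.

Lemma open_box_points_code (R : realType) (d : nat)
    (v : 'I_d.+1 -> 'rV[int]_d) :
  simplex_vertices R v ->
  open_box_points R v !=set0 <->
  exists2 c, simplex_code R v c & forall i, c 0 i != 0.
Proof.
move=> vs; split=> [[u [a a01 ua]]|[c [x [u xu] cx] c0]]; last first.
  (* Fractional parts are always below 1; one equal to 0 would make the corresponding code entry
     zero. *)
  exists u, (fun i => frac_part (x i)) => // i.
  have /andP[x0 ->] := frac_part_itv (x i).
  rewrite andbT lt_neqAle x0 andbT eq_sym.
  apply: contra (c0 i) => /eqP e.
  by rewrite -Zmod_repr_eq0 -(pnatr_eq0 R) cx e mulr0.
have fa j : frac_part (a j) = a j.
  by apply: frac_part_id; have /andP[/ltW -> ->] := a01 j.
have N0 := code_modulus_gt0 vs.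
have /choice[k kP] i : exists k : Zmod (code_modulus R v),
    (Zmod_repr k)%:R = (code_modulus R v)%:R * a i.
  have [k kN ka] := code_modulus_coef i vs a01 ua.
  (* Positivity of the modulus ensures that [Zmod] has exactly that many elements. *)
  have kN' : (k < (code_modulus R v).-1.+1)%N by rewrite prednK.
  by exists (Ordinal kN').
exists (\row_i k i) => [|i].
  exists a => [|i]; last by rewrite mxE fa.
  exists u; rewrite ua; congr cone_comb; exact/funext.
rewrite mxE -Zmod_repr_eq0 -(pnatr_eq0 R) kP mulf_neq0 ?pnatr_eq0 -?lt0n //.
by have /andP[/lt0r_neq0] := a01 i.
Qed.

(** Reading [x] as the coefficients of a combination of rows gives a codeword whose entry at [i] is,
    by commutativity, the pairing of column [i] with [x]. *)
Lemma arrangement_complementP (S : comPzRingType) (m n : nat)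
    (g : 'M[S]_(m, n)) :
  arrangement_complement g !=set0 <->
  exists2 c, row_span g c & forall i, c 0 i != 0.
Proof.
have coord (a : 'I_m -> S) i :
    (\sum_k a k *: row k g) 0 i = \sum_k col i g k 0 * a k.
  by rewrite summxE; apply: eq_bigr => k _; rewrite !mxE mulrC.
split=> [[x xP]|[_ [a ->] c0]].
  exists (\sum_k x k 0 *: row k g); first by exists (x^~ 0).
  by move=> i; apply/eqP; rewrite coord => e; apply: xP; exists i.
exists (\col_k a k) => -[i _]; rewrite /hyperplane /= => e.
move/eqP: (c0 i); apply; rewrite coord -[RHS]e.
by apply: eq_bigr => k _; rewrite !mxE.
Qed.

Theorem corollary2p11 (R : realType) (d : nat) (v : 'I_d.+1 -> 'rV[int]_d)
    (v_simplex : simplex_vertices R v)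
    (m : nat) (g : 'M[Zmod (code_modulus R v)]_(m, d.+1))
    (g_gen : row_span g = simplex_code R v) :
  thin R v <-> arrangement_complement g = set0.
Proof.
(* Both emptiness claims become negated existence claims, matched through the codewords without zero
   entry. *)
rewrite thinP -!nonemptyPn arrangement_complementP g_gen.
by rewrite (open_box_points_code v_simplex).
Qed.
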